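(* Let $f:\mathbb{B}\to\mathbb{H}$ be a slice regular function such that $\tilde d_2(f(\mathbb{B}))=2$, and let $\partial_c f(0)$ be its slice derivative at $0$. Then $$\tilde d_2(f(r\mathbb{B}))\le 2r\quad\text{for all } r\in(0,1) \qquad (A)$$ and $$|\partial_c f(0)|\le 1. \qquad (B)$$ Moreover, equality holds in (A) for some $r\in(0,1)$, or in (B), if and only if $f$ is an affine function of the form $f(q)=a+qb$ with $a,b\in\mathbb{H}$ and $|b|=1$.
   Context: $\mathbb{H}$ denotes the skew field of quaternions with its usual modulus, $\mathbb{B}=\{q\in\mathbb{H}:|q|<1\}$, $r\mathbb{B}=\{q\in\mathbb{H}:|q|<r\}$, $\mathbb{S}=\{q\in\mathbb{H}:q^2=-1\}$ is the sphere of imaginary units, and for $I\in\mathbb{S}$, $L_I=\mathbb{R}+\mathbb{R}I$ and $\mathbb{B}_I=\mathbb{B}\cap L_I$. A function $f:\mathbb{B}\to\mathbb{H}$ is slice regular if for every $I\in\mathbb{S}$ its restriction $f_I$ to $\mathbb{B}_I$ has continuous partial derivatives and satisfies $\frac12\big(\frac{\partial}{\partial x}+I\frac{\partial}{\partial y}\big)f_I(x+yI)=0$ for every $x+yI\in\mathbb{B}_I$. Equivalently, $f$ has a power series expansion $f(q)=\sum_{n\ge0}q^na_n$ with $a_n\in\mathbb{H}$, converging absolutely and uniformly on compact subsets of $\mathbb{B}$. The slice derivative is $\partial_c f(x+yI)=\frac{\partial}{\partial x}f(x+yI)$; in particular $\partial_c f(0)=a_1$. For $f(q)=\sum_{n\ge0}q^na_n$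 slice regular on $\mathbb{B}$ and $u\in\overline{\mathbb{B}}$, put $f_u(q)=\sum_{n\ge0}q^nu^na_n$. For $r\in(0,1)$ the regular diameter of the image of $r\mathbb{B}$ is $$\tilde d_2(f(r\mathbb{B}))=\max_{u,v\in\overline{\mathbb{B}}}\ \max_{|q|\le r}|f_u(q)-f_v(q)|,$$ and $\tilde d_2(f(\mathbb{B}))=\lim_{r\to1^-}\tilde d_2(f(r\mathbb{B}))$ (the limit of a non-decreasing function of $r$, possibly $+\infty$). *)

(* Defs.v *)
From HB Require Import structures.
From mathcomp Require Import all_boot all_order all_algebra.
From mathcomp Require Import ring lra.
From mathcomp Require Import all_classical all_reals all_analysis.

Set Implicit Arguments.
Unset Strict Implicit.
Unset Printing Implicit Defensive.

Import Order.TTheory GRing.Theory Num.Theory.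
Import numFieldNormedType.Exports.

Local Open Scope classical_set_scope.
Local Open Scope ring_scope.

(* [Quat a b c d] is the quaternion a + b i + c j + d k. *)
Record quat (R : Type) := Quat { q_re : R; q_i : R; q_j : R; q_k : R }.

Section QuatAlgebra.
Variable R : realType.
Implicit Types (x y z : quat R) (l : R).

Definition quat_to (x : quat R) : R * R * R * R :=
  (q_re x, q_i x, q_j x, q_k x).
Definition quat_of (t : R * R * R * R) : quat R :=
  let: (a, b, c, d) := t in Quat a b c d.

Lemma quat_toK : cancel quat_to quat_of.
Proof. by case. Qed.

HB.instance Definition _ := Choice.copy (quat R) (can_type quat_toK).

Lemma quatP x y : q_re x = q_re y -> q_i x = q_i y -> q_j x = q_j y ->
  q_k x = q_k y -> x = y.
Proof. by case: x y => ? ? ? ? [? ? ? ?] /= -> -> -> ->. Qed.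

Definition addq x y :=
  Quat (q_re x + q_re y) (q_i x + q_i y) (q_j x + q_j y) (q_k x + q_k y).
Definition oppq x := Quat (- q_re x) (- q_i x) (- q_j x) (- q_k x).
Definition scaleq l x :=
  Quat (l * q_re x) (l * q_i x) (l * q_j x) (l * q_k x).
Definition mulq x y := Quat
  (q_re x * q_re y - q_i x * q_i y - q_j x * q_j y - q_k x * q_k y)
  (q_re x * q_i y + q_i x * q_re y + q_j x * q_k y - q_k x * q_j y)
  (q_re x * q_j y - q_i x * q_k y + q_j x * q_re y + q_k x * q_i y)
  (q_re x * q_k y + q_i x * q_j y - q_j x * q_i y + q_k x * q_re y).
Definition zeroq : quat R := Quat 0 0 0 0.
Definition oneq : quat R := Quat 1 0 0 0.

Lemma addqA : associative addq.
Proof. by move=> x y z; apply: quatP => /=; ring. Qed.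
Lemma addqC : commutative addq.
Proof. by move=> x y; apply: quatP => /=; ring. Qed.
Lemma add0q : left_id zeroq addq.
Proof. by move=> x; apply: quatP => /=; ring. Qed.
Lemma addNq : left_inverse zeroq oppq addq.
Proof. by move=> x; apply: quatP => /=; ring. Qed.

HB.instance Definition _ :=
  GRing.isZmodule.Build (quat R) addqA addqC add0q addNq.

Lemma mulqA : associative mulq.
Proof. by move=> x y z; apply: quatP => /=; ring. Qed.
Lemma mul1q : left_id oneq mulq.
Proof. by move=> x; apply: quatP => /=; ring. Qed.
Lemma mulq1 : right_id oneq mulq.
Proof. by move=> x; apply: quatP => /=; ring. Qed.
Lemma mulqDl : left_distributive mulq +%R.
Proof. by move=> x y z; apply: quatP => /=; ring. Qed.
Lemma mulqDr : right_distributive mulq +%R.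
Proof. by move=> x y z; apply: quatP => /=; ring. Qed.
Lemma oneq_neq0 : oneq != 0.
Proof. by apply/eqP => -[/eqP]; rewrite oner_eq0. Qed.

HB.instance Definition _ := GRing.Zmodule_isNzRing.Build (quat R)
  mulqA mul1q mulq1 mulqDl mulqDr oneq_neq0.

Lemma scaleqA l1 l2 x : scaleq l1 (scaleq l2 x) = scaleq (l1 * l2) x.
Proof. by apply: quatP => /=; ring. Qed.
Lemma scale1q : left_id 1 scaleq.
Proof. by move=> x; apply: quatP => /=; ring. Qed.
Lemma scaleqDr : right_distributive scaleq +%R.
Proof. by move=> l x y; apply: quatP => /=; ring. Qed.
Lemma scaleqDl x : {morph scaleq^~ x : a b / a + b}.
Proof. by move=> a b; apply: quatP => /=; ring. Qed.

HB.instance Definition _ := GRing.Zmodule_isLmodule.Build R (quat R)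
  scaleqA scale1q scaleqDr scaleqDl.

Lemma scaleqAl l x y : l *: (x * y) = (l *: x) * y.
Proof. by apply: quatP => /=; ring. Qed.
Lemma scaleqAr l x y : l *: (x * y) = x * (l *: y).
Proof. by apply: quatP => /=; ring. Qed.

HB.instance Definition _ := GRing.Lmodule_isLalgebra.Build R (quat R) scaleqAl.
HB.instance Definition _ := GRing.Lalgebra_isAlgebra.Build R (quat R) scaleqAr.

Definition normq x : R :=
  Num.sqrt (q_re x ^+ 2 + q_i x ^+ 2 + q_j x ^+ 2 + q_k x ^+ 2).

Let sqn x := q_re x ^+ 2 + q_i x ^+ 2 + q_j x ^+ 2 + q_k x ^+ 2.

Let sqn_ge0 x : 0 <= sqn x.
Proof. by rewrite !addr_ge0 ?sqr_ge0. Qed.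

Lemma ler_normqD x y : normq (x + y) <= normq x + normq y.
Proof.
have nx := sqrtr_ge0 (sqn x); have ny := sqrtr_ge0 (sqn y).
rewrite -(@ler_pXn2r _ 2) ?nnegrE ?sqrtr_ge0 ?addr_ge0 //.
rewrite sqrrD !sqr_sqrtr ?sqn_ge0 // -sqrtrM ?sqn_ge0 //.
pose dot := q_re x * q_re y + q_i x * q_i y + q_j x * q_j y + q_k x * q_k y.
have dot_le : dot <= Num.sqrt (sqn x * sqn y).
  apply: le_trans (ler_norm _) _; rewrite -sqrtr_sqr ler_sqrt; last first.
    by rewrite mulr_ge0.
  rewrite -subr_ge0 /dot /sqn.
  set D := (X in 0 <= X).
  have -> : D = (q_re x * q_i y - q_i x * q_re y) ^+ 2
    + (q_re x * q_j y - q_j x * q_re y) ^+ 2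
    + (q_re x * q_k y - q_k x * q_re y) ^+ 2
    + (q_i x * q_j y - q_j x * q_i y) ^+ 2
    + (q_i x * q_k y - q_k x * q_i y) ^+ 2
    + (q_j x * q_k y - q_k x * q_j y) ^+ 2 by rewrite /D; ring.
  by rewrite !addr_ge0 ?sqr_ge0.
rewrite -/(sqn x) -/(sqn y); move: dot_le; rewrite /dot /sqn /=; lra.
Qed.

Lemma normqZ l x : normq (l *: x) = `|l| * normq x.
Proof.
rewrite /normq -sqrtr_sqr -sqrtrM ?sqr_ge0 //; congr Num.sqrt => /=; ring.
Qed.

Lemma normq0_eq0 x : normq x = 0 -> x = 0.
Proof.
move/eqP; rewrite sqrtr_eq0 => le0.
have h a : a ^+ 2 <= sqn x -> a = 0.
  move=> /le_trans /(_ le0) a0; apply/eqP; rewrite -sqrf_eq0.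
  by rewrite eq_le a0 sqr_ge0.
have := sqr_ge0 (q_re x); have := sqr_ge0 (q_i x).
have := sqr_ge0 (q_j x); have := sqr_ge0 (q_k x).
by move=> *; apply: quatP; apply: h; rewrite /sqn; lra.
Qed.

HB.instance Definition _ :=
  Lmodule_isNormed.Build R (quat R) ler_normqD normqZ normq0_eq0.

End QuatAlgebra.

Section SliceRegular.
Variable R : realType.
Notation H := (quat R).
Implicit Types (f : H -> H) (a : nat -> H).

(* A function on the open unit ball B is represented by a total function on H;
   every notion below depends only on its values on B. *)
Definition unit_ball : set H := [set q | `|q| < 1].

Definition imag_units : set H := [set I | I ^+ 2 = -1].

Definition slice_plane (I : H) : set H :=
  [set q | exists x y : R, q = x%:A + y *: I].

Definition ball_slice (I : H) : set H := unit_ball `&` slice_plane I.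

(* At q = x + y I, the directional derivatives 'D_1 f q and 'D_I f q are the
   partial derivatives in x and in y of (x, y) |-> f (x + y I). *)
Definition slice_regular f : Prop :=
  forall I, imag_units I ->
  [/\ forall q, ball_slice I q -> derivable f q 1 /\ derivable f q I,
      {within ball_slice I, continuous (fun q => 'D_1 f q)},
      {within ball_slice I, continuous (fun q => 'D_I f q)} &
      forall q, ball_slice I q ->
        (2^-1 : R) *: ('D_1 f q + I * 'D_I f q) = 0].

Definition slice_derivative f (q : H) : H := 'D_1 f q.

Definition power_series a (q : H) : H :=
  limn (series (fun n => q ^+ n * a n)).

Definition is_expansion f a : Prop :=
  forall q, unit_ball q -> series (fun n => q ^+ n * a n) @ \oo --> f q.

(* The coefficients a_n of the expansion f(q) = sum_n q^n a_n on B; it exists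
   and is unique when f is slice regular. *)
Definition slice_coef f : nat -> H := xget (fun=> 0) [set a | is_expansion f a].

Definition slice_rot f (u : H) : H -> H :=
  power_series (fun n => u ^+ n * slice_coef f n).

Local Open Scope ereal_scope.

Definition regular_diameter f (r : R) : \bar R :=
  ereal_sup [set d | exists u v q : H,
    [/\ (`|u| <= 1)%R, (`|v| <= 1)%R, (`|q| <= r)%R &
        d = (`|slice_rot f u q - slice_rot f v q|)%:E] ].

Definition regular_diameter_ball f : \bar R :=
  lim (regular_diameter f r @[r --> (1%R : R)^'-]).

End SliceRegular.

(* Main.v *)
Require Import Defs.
From mathcomp Require Import all_boot all_order all_algebra.
From mathcomp Require Import ring lra.
From mathcomp Require Import all_classical all_reals all_analysis.

Set Implicit Arguments.
Unset Strict Implicit.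
Unset Printing Implicit Defensive.

Import Order.TTheory GRing.Theory Num.Theory.
Import numFieldNormedType.Exports.

Local Open Scope classical_set_scope.
Local Open Scope ring_scope.

(** Write [a n] for the coefficients of [f]; they exist because otherwise the
    diameter would be 0. The hypothesis says that for all [u], [v] in the closed
    ball the series [g (q) = sum q^n (u^n - v^n) a_n] is bounded by 2 on the unit
    ball. As [g] vanishes at 0, inequality (A) is the Schwarz lemma
    [|g (q)| <= 2 |q|].

    The Schwarz lemma is proved slice by slice with nothing more than finite
    averages. Fix [w] and an imaginary unit [I] commuting with [w], and divide by
    the variable: [g (q) / q = sum q^m c_m]. Averaging over the two points
    [exp (+- I t) w] gives the cosine series [sum cos (m t) w^m c_m], bounded by
    [2 / |w|] for every angle [t]. Bounds on the coefficients of a bounded cosine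
    series come from averaging it over the N-th roots of unity against nonnegative
    weights and letting N grow ([cosine_bounded_moments]). Two families of weights
    suffice. The weights [1 + t cos (n theta)] control the constant coefficient
    together with the n-th one ([cosine_coef_bound]). Poisson weights, whose
    cosine moments tend to [s^m] ([cvg_poisson_moment]), give the maximum
    principle; since they are bounded below they even give the strict form
    [|g (q)| <= |q| (2 - 2 p (1 - |a 1|))], with [p > 0] depending only on a bound
    [r < 1] for [|q|] ([rot_schwarz]). The constant coefficient for [u = 1],
    [v = -1] is [2 a_1], so [|a 1| <= 1] ([coef1_le1]), which is (B) because the
    slice derivative at 0 is [a 1] ([slice_derivative0]). Hence (A), and equality
    in (A) for one [r] forces [|a 1| = 1].

    Suppose [|a 1| = 1]. With [u = 1], [v = -1] the constant coefficient has
    already the largest possible norm, so the other ones vanish: [a n = 0] for odd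
    [n > 1] ([odd_coef_eq0]). Consequently [f (z) - f (- z) = 2 z a_1], so the
    chord from [f (- z)] to [f (z)] realizes the diameter of the image of the ball
    of radius [|z|], and moving its two ends along the circle can lengthen it only
    to second order. The first order change, averaged over two angles symmetric
    about [x], is a cosine series, so each of its coefficients is zero
    ([twist_eq0]); these are the inner products of [a 1] with multiples of
    [I exp ((n - 1) I x) a_n], for all [I] and [x], whence [a n = 0] for [n > 1]
    ([coef_eq0]). *)

(** * Norm and inner product of quaternions *)

Section QuaternionNorm.
Context {R : realType}.
Implicit Types x y z q I : quat R.

Definition dotq x y : R :=
  q_re x * q_re y + q_i x * q_i y + q_j x * q_j y + q_k x * q_k y.

Lemma normq_sqr x : `|x| ^+ 2 = dotq x x.
Proof.
rewrite /Num.Def.normr /= /normq sqr_sqrtr; first by rewrite /dotq; ring.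
by rewrite !addr_ge0 ?sqr_ge0.
Qed.

Lemma dotq_mull z x y : dotq (z * x) (z * y) = `|z| ^+ 2 * dotq x y.
Proof. by rewrite normq_sqr /dotq /=; ring. Qed.

Lemma normqM x y : `|x * y| = `|x| * `|y|.
Proof.
apply/eqP; rewrite -(@eqrXn2 _ 2) ?mulr_ge0 ?normr_ge0 //; apply/eqP.
by rewrite exprMn [LHS]normq_sqr dotq_mull [`|y| ^+ 2]normq_sqr.
Qed.

Lemma normq1 : `|1 : quat R| = 1.
Proof.
apply/eqP; rewrite -(@eqrXn2 _ 2) ?normr_ge0 // normq_sqr /dotq /=.
by rewrite !(mulr0, mulr1, addr0) expr1n.
Qed.

Lemma normqX x n : `|x ^+ n| = `|x| ^+ n.
Proof.
elim: n => [|n IH]; last by rewrite !exprS normqM IH.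
by rewrite !expr0 normq1.
Qed.

Lemma dotqDr x y z : dotq x (y + z) = dotq x y + dotq x z.
Proof. by rewrite /dotq /=; ring. Qed.

Lemma dotqZl c x y : dotq (c *: x) y = c * dotq x y.
Proof. by rewrite /dotq /=; ring. Qed.

Lemma dotqZr c x y : dotq x (c *: y) = c * dotq x y.
Proof. by rewrite /dotq /=; ring. Qed.

Lemma dotq_sumr x (n : nat) (F : 'I_n -> quat R) :
  dotq x (\sum_(i < n) F i) = \sum_(i < n) dotq x (F i).
Proof.
elim: n F => [|n IH] F; last by rewrite !big_ord_recr dotqDr IH.
by rewrite !big_ord0 /dotq /=; ring.
Qed.

Lemma normqD_sqr x y :
  `|x + y| ^+ 2 = `|x| ^+ 2 + dotq x y *+ 2 + `|y| ^+ 2.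
Proof. by rewrite !normq_sqr /dotq /=; ring. Qed.

Lemma normqB_sqr x y :
  `|x - y| ^+ 2 = `|x| ^+ 2 - dotq x y *+ 2 + `|y| ^+ 2.
Proof. by rewrite !normq_sqr /dotq /=; ring. Qed.

(** The four numbers are, up to sign, the coordinates of [y * conj x]. *)
Lemma dotq_units_eq0 x y : x != 0 -> dotq x y = 0 ->
    (forall I, I ^+ 2 = -1 -> dotq x (I * y) = 0) ->
  y = 0.
Proof.
move=> x0 xy xIy.
have hi : dotq x (Quat 0 1 0 0 * y) = 0.
  by apply: xIy; rewrite expr2; apply: quatP => /=; ring.
have hj : dotq x (Quat 0 0 1 0 * y) = 0.
  by apply: xIy; rewrite expr2; apply: quatP => /=; ring.
have hk : dotq x (Quat 0 0 0 1 * y) = 0.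
  by apply: xIy; rewrite expr2; apply: quatP => /=; ring.
have : `|x| ^+ 2 * `|y| ^+ 2 = 0.
  transitivity (dotq x y ^+ 2 + dotq x (Quat 0 1 0 0 * y) ^+ 2
    + dotq x (Quat 0 0 1 0 * y) ^+ 2 + dotq x (Quat 0 0 0 1 * y) ^+ 2).
    by rewrite !normq_sqr /dotq /=; ring.
  by rewrite xy hi hj hk; ring.
move/eqP; rewrite mulf_eq0 !expf_eq0 /= !normr_eq0 (negbTE x0) /=.
by move/eqP.
Qed.

Lemma imag_unit_re0 I : I ^+ 2 = -1 -> q_re I = 0.
Proof.
move=> II; have n1 : dotq I I = 1.
  apply/eqP; rewrite -(@eqrXn2 _ 2) // ?expr1n.
    by rewrite -normq_sqr -normqX II normrN normq1 expr1n.
  by rewrite -normq_sqr sqr_ge0.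
have := congr1 (@q_re R) II; rewrite expr2 /= => e.
have : q_re I ^+ 2 = 0 by move: n1 e; rewrite /dotq /=; lra.
by move/eqP; rewrite sqrf_eq0 => /eqP.
Qed.
End QuaternionNorm.

(** * Unit circles of the slices *)

Section SliceCircle.
Context {R : realType}.
Implicit Types (q I : quat R) (t : R).

Definition expi I t : quat R := cos t *: 1 + sin t *: I.

Lemma expi0 I : expi I 0 = 1.
Proof. by rewrite /expi cos0 sin0 scale1r scale0r addr0. Qed.

Lemma expiD I s t : I ^+ 2 = -1 -> expi I (s + t) = expi I s * expi I t.
Proof.
move=> II; rewrite /expi cosD sinD mulrDl !mulrDr -!scalerAl -!scalerAr.
by rewrite !mul1r !mulr1 -expr2 II; apply: quatP => /=; ring.
Qed.

Lemma expiX I t n : I ^+ 2 = -1 -> expi I t ^+ n = expi I (n%:R * t).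
Proof.
move=> II; elim: n => [|n IH]; first by rewrite mul0r expi0.
by rewrite exprS IH -expiD // -[X in X + _]mul1r -mulrDl -natr1 addrC.
Qed.

Lemma normq_expi I t : I ^+ 2 = -1 -> `|expi I t| = 1.
Proof.
move=> II; have I0 := imag_unit_re0 II.
have nI : `|I| = 1.
  apply/eqP; rewrite -(@eqrXn2 _ 2) ?normr_ge0 // -normqX II normrN normq1.
  by rewrite expr1n.
apply/eqP; rewrite -(@eqrXn2 _ 2) ?normr_ge0 // expr1n /expi normqD_sqr.
rewrite !normrZ nI normq1 !mulr1 !real_normK ?num_real // dotqZl dotqZr.
by rewrite {1}/dotq /= I0 !(mulr0, mul0r, addr0, mul0rn) cos2Dsin2.
Qed.

Lemma expi_comm I q t : GRing.comm I q -> GRing.comm (expi I t) q.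
Proof.
move=> Iq; rewrite /GRing.comm /expi mulrDl mulrDr -!scalerAl -!scalerAr.
by rewrite mul1r mulr1 Iq.
Qed.

Lemma expi_addN I a t :
  I ^+ 2 = -1 -> expi I (a + t) + expi I (a - t) = (2 * cos t) *: expi I a.
Proof.
move=> II; rewrite /expi cosD cosB sinD sinB.
by apply: quatP => /=; ring.
Qed.

Lemma expi_subN I a t : I ^+ 2 = -1 ->
  expi I (a + t) - expi I (a - t) = (2 * sin t) *: (I * expi I a).
Proof.
move=> II; rewrite /expi mulrDr -!scalerAr mulr1 -expr2 II cosD cosB sinD sinB.
by apply: quatP => /=; ring.
Qed.

Lemma exists_imag_unit_comm q : exists2 I : quat R, I ^+ 2 = -1 & GRing.comm I q.
Proof.
pose v := Quat 0 (q_i q) (q_j q) (q_k q).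
have qv : q = q_re q *: 1 + v by apply: quatP => /=; ring.
have vcomm : GRing.comm v q by rewrite /GRing.comm; apply: quatP => /=; ring.
have [v0|v0] := eqVneq v 0.
  exists (Quat 0 1 0 0); first by rewrite expr2; apply: quatP => /=; ring.
  by rewrite qv v0 /GRing.comm; apply: quatP => /=; ring.
exists (`|v|^-1 *: v); last by rewrite /GRing.comm -scalerAl -scalerAr vcomm.
rewrite expr2 -scalerAl -scalerAr scalerA -invfM -expr2.
have -> : v * v = - (`|v| ^+ 2 *: 1).
  by rewrite normq_sqr /dotq; apply: quatP => /=; ring.
by rewrite scalerN scalerA mulVf ?scale1r // expf_eq0 /= normr_eq0.
Qed.
End SliceCircle.

(** * Equidistributed nodes on the circle *)

Section Nodes.
Context {R : realType}.
Implicit Types (N k m n : nat).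

Definition node N k : R := pi *+ 2 * k%:R / N%:R.

Definition node_mean N (F : R -> R) : R :=
  N%:R^-1 * \sum_(k < N) F (node N k).

Lemma node_mean_cos0 N : (0 < N)%N -> node_mean N (fun t => cos (0%:R * t)) = 1.
Proof.
move=> N0; rewrite /node_mean (eq_bigr (fun=> 1)) => [|k _].
  by rewrite sumr_const card_ord mulVf // pnatr_eq0 -lt0n.
by rewrite mul0r cos0.
Qed.

(** After multiplication by [2 sin (pi m / N)], which is positive in this
    range, the sum telescopes over one full period. *)
Lemma sum_cos_node N m : (0 < m < N)%N ->
  \sum_(k < N) cos (m%:R * node N k) = 0.
Proof.
move=> /andP[m0 mN]; set h : R := pi * m%:R / N%:R.
have N0 : N%:R != 0 :> R by rewrite pnatr_eq0 -lt0n (ltn_trans m0).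
have sinh : sin h != 0.
  rewrite gt_eqF // sin_gt0_pi // /h -mulrA mulr_gt0 ?pi_gt0 //=; last first.
    by rewrite divr_gt0 // ltr0n // (ltn_trans m0).
  rewrite gtr_pMr ?pi_gt0 // ltr_pdivrMr ?ltr0n ?(ltn_trans m0) //.
  by rewrite mul1r ltr_nat.
apply: (mulfI (_ : 2 * sin h != 0)); first by rewrite mulf_neq0.
pose F k := sin ((k%:R *+ 2 - 1) * h).
transitivity (\sum_(0 <= k < N) (F k.+1 - F k)).
  rewrite mulr_sumr big_mkord; apply: eq_bigr => k _; rewrite /F.
  have -> : m%:R * node N k = k%:R *+ 2 * h.
    by rewrite /node /h; field.
  rewrite [k.+1%:R]mulrSr; set x := k%:R *+ 2 * h.
  have -> : ((k%:R + 1) *+ 2 - 1) * h = x + h by rewrite /x; ring.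
  have -> : (k%:R *+ 2 - 1) * h = x - h by rewrite /x; ring.
  by rewrite sinD sinB; ring.
rewrite telescope_sumr // /F mulr0.
have -> : (N%:R *+ 2 - 1) * h = - h + pi *+ 2 *+ m.
  by rewrite /h; field.
have -> : (0%:R *+ 2 - 1) * h = - h by ring.
by rewrite (periodicn (@sinD2pi R)) subrr.
Qed.

Lemma node_mean_cos N m : (0 < m < N)%N ->
  node_mean N (fun t => cos (m%:R * t)) = 0.
Proof. by move=> mN; rewrite /node_mean sum_cos_node ?mulr0. Qed.

Lemma node_meanD N F G :
  node_mean N (fun t => F t + G t) = node_mean N F + node_mean N G.
Proof. by rewrite /node_mean big_split mulrDr. Qed.

Lemma node_meanZ N c F : node_mean N (fun t => c * F t) = c * node_mean N F.
Proof. by rewrite /node_mean -mulr_sumr mulrCA. Qed.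

Lemma node_mean_le N (F G : R -> R) : (forall t, F t <= G t) ->
  node_mean N F <= node_mean N G.
Proof.
by move=> FG; rewrite /node_mean ler_wpM2l ?invr_ge0 // ler_sum.
Qed.

Lemma node_mean_cst N (c : R) : (0 < N)%N -> node_mean N (fun=> c) = c.
Proof.
move=> N0; rewrite /node_mean sumr_const card_ord -[c *+ N]mulr_natl mulrA mulVf ?mul1r //.
by rewrite pnatr_eq0 -lt0n.
Qed.

Lemma ler_norm_node_mean N (F : R -> R) :
  `|node_mean N F| <= node_mean N (fun t => `|F t|).
Proof.
rewrite /node_mean normrM ger0_norm ?invr_ge0 // ler_wpM2l ?invr_ge0 //.
exact: ler_norm_sum.
Qed.
End Nodes.

(** * Bounded cosine series *)

Section CosineSeries.
Context {R : realType} {V : normedModType R}.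
Implicit Types (x : nat -> V) (M t s : R).

Definition cosine_sum x (n : nat) t : V :=
  \sum_(m < n) cos (m%:R * t) *: x m.

(** Only the partial sums are constrained, up to an error vanishing uniformly
    in the angle: averaging over nodes then stays within finite sums. *)
Definition cosine_bounded x M :=
  forall e, 0 < e -> \forall n \near \oo, forall t, `|cosine_sum x n t| <= M + e.

(** A mean over nodes only reorders a finite sum, so it multiplies each
    coefficient [x m] by the m-th cosine moment of the weights. The limit in [N] is
    taken on a fixed partial sum. *)
Lemma cosine_bounded_moments x M W (w : nat -> R -> R) (j : nat -> R) :
  cosine_bounded x M -> 0 <= W ->
  (\forall N \near \oo, node_mean N (fun t => `|w N t|) <= W) ->
  (forall m, node_mean N (fun t => w N t * cos (m%:R * t)) @[N --> \oo] --> j m) ->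
  forall e, 0 < e ->
    \forall n \near \oo, `|\sum_(m < n) j m *: x m| <= W * (M + e).
Proof.
move=> xM W0 wW wj e e0; apply: filterS (xM e e0) => n xn.
pose J N m := node_mean N (fun t => w N t * cos (m%:R * t)).
have cvgJ : \sum_(m < n) J N m *: x m @[N --> \oo] --> \sum_(m < n) j m *: x m.
  apply: (cvg_big add_continuous) => m _; apply: cvgZr_tmp; exact: wj.
apply: (cvgr_to_le (cvg_norm cvgJ)); apply: filterS wW => N wN /=.
have -> : \sum_(m < n) J N m *: x m =
    N%:R^-1 *: \sum_(k < N) w N (node N k) *: cosine_sum x n (node N k).
  rewrite scaler_sumr /cosine_sum.
  under [RHS]eq_bigr do rewrite scaler_sumr scaler_sumr.
  rewrite exchange_big /=; apply: eq_bigr => m _.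
  rewrite /J /node_mean mulr_sumr scaler_suml; apply: eq_bigr => k _.
  by rewrite !scalerA mulrA.
have M0 : 0 <= M + e by exact: le_trans (xn 0).
rewrite normrZ ger0_norm ?invr_ge0 //.
apply: le_trans (ler_wpM2r M0 wN); rewrite /node_mean -mulrA.
rewrite ler_wpM2l ?invr_ge0 // mulr_suml (le_trans (ler_norm_sum _ _ _)) //.
by apply: ler_sum => k _; rewrite normrZ ler_wpM2l.
Qed.

(** The weights are the Fejer-Riesz-type kernels [1 + t cos (n theta)], which
    are nonnegative, have mass one and see only the moments 0 and n. *)
Lemma cosine_coef_bound x M n t : cosine_bounded x M -> (0 < n)%N ->
  `|t| <= 1 -> `|x 0%N + (t / 2) *: x n| <= M.
Proof.
move=> xM n0 t1; pose w (N : nat) a := 1 + t * cos (n%:R * a).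
have w0 N a : 0 <= w N a.
  rewrite /w addrC -lerBlDr sub0r lerNl.
  apply: le_trans (ler_norm _) _; rewrite normrN normrM.
  by rewrite mulr_ile1 ?cos_max.
have mean1 N : (n < N)%N -> node_mean N (fun a => `|w N a|) = 1.
  move=> nN; transitivity (node_mean N (fun a => cos (0%:R * a)
      + t * cos (n%:R * a))).
    rewrite /node_mean; congr (_ * _); apply: eq_bigr => k _.
    by rewrite ger0_norm // mul0r cos0.
  by rewrite node_meanD node_meanZ node_mean_cos0 ?(ltn_trans n0 nN) //
    node_mean_cos ?n0 // mulr0 addr0.
pose j m : R := (m == 0%N)%:R + t / 2 * (m == n)%:R.
have wj m : node_mean N (fun a => w N a * cos (m%:R * a)) @[N --> \oo] --> j m.
  apply: cvg_near_cst; near=> N.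
  have Nbig : (m + n < N)%N by near: N; exact: nbhs_infty_gt.
  have N0 : (0 < N)%N := leq_ltn_trans (leq0n _) Nbig.
  pose d := if (m <= n)%N then (n - m)%N else (m - n)%N.
  have cosd a : cos (d%:R * a) = cos (m%:R * a - n%:R * a).
    rewrite /d -mulrBl; case: leqP => [mn|/ltnW nm]; rewrite natrB //.
    by rewrite -opprB mulNr cosN.
  have meanE k : (k <= m + n)%N ->
      node_mean N (fun a => cos (k%:R * a)) = (k == 0%N)%:R :> R.
    move=> kmn; case: (posnP k) => [->|k0]; first exact: node_mean_cos0.
    by rewrite node_mean_cos ?k0 ?(leq_ltn_trans kmn) // gtn_eqF.
  transitivity (node_mean N (fun a => cos (m%:R * a)
      + (t / 2 * cos ((m + n)%:R * a) + t / 2 * cos (d%:R * a)))).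
    rewrite /node_mean; congr (_ * _); apply: eq_bigr => k _.
    by rewrite cosd natrD [(_%:R + _%:R) * _]mulrDl cosD cosB /w; field.
  have dle : (d <= m + n)%N.
    rewrite /d; case: ifP => _; apply: leq_trans (leq_subr _ _) _.
      exact: leq_addl.
    exact: leq_addr.
  rewrite !node_meanD !node_meanZ !meanE ?leq_addr // /j.
  rewrite addn_eq0 (gtn_eqF n0) andbF mulr0 add0r.
  congr (_ + _ * (nat_of_bool _)%:R); rewrite /d; case: leqP => [mn|nm].
    by rewrite subn_eq0 [RHS]eqn_leq mn.
  by rewrite subn_eq0 leqNgt nm (gtn_eqF nm).
apply/ler_addgt0Pr => e e0.
have w1 : \forall N \near \oo, node_mean N (fun a => `|w N a|) <= 1.
  by near=> N; rewrite mean1 //; near: N; exact: nbhs_infty_gt.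
have := cosine_bounded_moments xM ler01 w1 wj e0; rewrite mul1r => h.
near \oo => L; have Ln : (n < L)%N by near: L; exact: nbhs_infty_gt.
have : `|\sum_(m < L) j m *: x m| <= M + e by near: L; exact: h.
have -> // : \sum_(m < L) j m *: x m = x 0%N + (t / 2) *: x n.
have L0 : (0 < L)%N := ltn_trans n0 Ln.
rewrite (bigD1 (Ordinal L0)) //= (bigD1 (Ordinal Ln)) /=; last first.
  by rewrite -val_eqE /= gtn_eqF.
rewrite big1 => [|i /andP[i0 i1]]; rewrite /j.
  by rewrite eqxx (ltn_eqF n0) (gtn_eqF n0) eqxx !(mulr0, mulr1, addr0, add0r)
    scale1r.
move: i0 i1; rewrite -!val_eqE /= => /negbTE-> /negbTE->.
by rewrite mulr0 addr0 scale0r.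
Unshelve. all: by end_near.
Qed.

Lemma cosine_coef0_bound x M : cosine_bounded x M -> `|x 0%N| <= M.
Proof.
move=> xM; have := @cosine_coef_bound x M 1 0 xM isT.
by rewrite normr0 mul0r scale0r addr0; apply.
Qed.

Lemma cosine_coefn_bound x M n : cosine_bounded x M -> (0 < n)%N ->
  `|x n| <= 2 * M.
Proof.
move=> xM n0; have h t : `|t| <= 1 -> _ := @cosine_coef_bound x M n t xM n0.
have -> : x n = x 0%N + (1 / 2) *: x n - (x 0%N + (- 1 / 2) *: x n).
  rewrite opprD addrACA subrr add0r -scalerBl.
  by rewrite (_ : _ - _ = 1) ?scale1r //; field.
apply: le_trans (ler_normB _ _) _; rewrite mulr_natl mulr2n lerD // h //.
  by rewrite normr1.
by rewrite normrN normr1.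
Qed.
End CosineSeries.

(** * Poisson averages *)

Section PoissonNodes.
Context {R : realType}.
Variable s : R.
Hypothesis s01 : 0 <= s < 1.
Implicit Types (N m : nat) (t : R).

Let s0 : 0 <= s. Proof. by case/andP: s01. Qed.
Let s1 : s < 1. Proof. by case/andP: s01. Qed.

Definition poisson_denom t : R := 1 + s ^+ 2 - 2 * s * cos t.

Lemma poisson_denom_ge t : (1 - s) ^+ 2 <= poisson_denom t.
Proof.
rewrite /poisson_denom; have := ler_wpM2l s0 (cos_le1 t).
by rewrite mulr1; move: (cos t) => c; lra.
Qed.

Lemma poisson_denom_le t : poisson_denom t <= (1 + s) ^+ 2.
Proof.
rewrite /poisson_denom; have := ler_wpM2l s0 (cos_geN1 t).
by rewrite mulrN1; move: (cos t) => c; lra.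
Qed.

Let d_gt0 : 0 < (1 - s) ^+ 2.
Proof. by rewrite exprn_gt0 // subr_gt0. Qed.

Lemma poisson_denom_gt0 t : 0 < poisson_denom t.
Proof. exact: lt_le_trans d_gt0 (poisson_denom_ge t). Qed.

Definition poisson_mass N := node_mean N (fun t => (poisson_denom t)^-1).

Lemma poisson_mass_gt0 N : (0 < N)%N -> 0 < poisson_mass N.
Proof.
move=> N0; apply: (@lt_le_trans _ _ ((1 + s) ^+ 2)^-1).
  by rewrite invr_gt0 exprn_gt0 // ltr_wpDr.
rewrite -[leLHS](node_mean_cst _ N0); apply: node_mean_le => t.
rewrite lef_pV2 ?poisson_denom_le // posrE ?poisson_denom_gt0 //.
by rewrite exprn_gt0 // ltr_wpDr.
Qed.

Lemma poisson_mass_le N : (0 < N)%N -> poisson_mass N <= ((1 - s) ^+ 2)^-1.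
Proof.
move=> N0; rewrite -[leRHS](node_mean_cst _ N0); apply: node_mean_le => t.
by rewrite lef_pV2 ?poisson_denom_ge // posrE ?poisson_denom_gt0.
Qed.

Definition poisson_moment N m :=
  node_mean N (fun t => (poisson_denom t)^-1 * cos (m%:R * t)) / poisson_mass N.

Lemma poisson_moment0 N : (0 < N)%N -> poisson_moment N 0 = 1.
Proof.
move=> N0; rewrite /poisson_moment -[RHS](@divff _ (poisson_mass N)); last first.
  by rewrite gt_eqF ?poisson_mass_gt0.
congr (_ / _); rewrite /poisson_mass /node_mean; congr (_ * _).
by apply: eq_bigr => k _; rewrite mul0r cos0 mulr1.
Qed.

Lemma poisson_moment_le1 N m : (0 < N)%N -> `|poisson_moment N m| <= 1.
Proof.
move=> N0; have C0 := poisson_mass_gt0 N0.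
rewrite /poisson_moment normrM [`|_^-1|]gtr0_norm ?invr_gt0 //.
rewrite ler_pdivrMr // mul1r.
apply: le_trans (ler_norm_node_mean _ _) _; apply: node_mean_le => t.
have d0 := poisson_denom_gt0 t.
by rewrite normrM gtr0_norm ?invr_gt0 // ler_piMr ?cos_max // invr_ge0 ltW.
Qed.

(** [poisson_denom] inverts the Poisson weight, and multiplying by it
    combines three consecutive moments into a mean of [cos (m t)]. *)
Lemma poisson_moment_rec N m : (m.+1 < N)%N ->
  s * (poisson_moment N m.+2 + poisson_moment N m) =
  (1 + s ^+ 2) * poisson_moment N m.+1.
Proof.
move=> mN; rewrite /poisson_moment -mulrDl mulrA [RHS]mulrA; congr (_ / _).
apply/eqP; rewrite -subr_eq0 -oppr_eq0 opprB; apply/eqP.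
rewrite -[RHS](@node_mean_cos R N m.+1) ?mN // -mulNr.
rewrite -node_meanD -!node_meanZ -node_meanD /node_mean; congr (_ * _).
apply: eq_bigr => k _; set t := node N k.
have d0 : poisson_denom t != 0 by rewrite gt_eqF ?poisson_denom_gt0.
apply: (mulfI d0).
have -> : m.+2%:R * t = m.+1%:R * t + t by rewrite [m.+2%:R]mulrSr; ring.
have -> : m%:R * t = m.+1%:R * t - t by rewrite [m.+1%:R]mulrSr; ring.
rewrite cosB cosD; move: d0; rewrite /poisson_denom => d0.
by field.
Qed.

(** By the recurrence, the defect from a geometric progression at [m] is [s] times
    the defect at [m + 1]. Every defect is at most 2 and [j] can be taken as large
    as [N - 1 - m], so for a fixed [m] the defect is tiny when [N] is large. *)
Lemma poisson_moment_step N m j : (m + j < N)%N ->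
  `|poisson_moment N m.+1 - s * poisson_moment N m| <= 2 * s ^+ j.
Proof.
have [N0|/lt0n_neq0/eqP N0] := posnP N; first by rewrite N0.
have NN : (0 < N)%N by rewrite lt0n; apply/eqP.
elim: j m => [|j IH] m mjN.
  rewrite expr0 mulr1; apply: le_trans (ler_normB _ _) _.
  rewrite (_ : 2 = 1 + 1) // lerD ?poisson_moment_le1 // normrM ger0_norm //.
  by rewrite mulr_ile1 ?poisson_moment_le1 // ltW.
rewrite (_ : _ - _ = s * (poisson_moment N m.+2 - s * poisson_moment N m.+1)).
  rewrite normrM ger0_norm // exprS [leRHS]mulrCA ler_wpM2l // IH //.
  by rewrite addSn -addnS.
have := @poisson_moment_rec N m; rewrite (leq_ltn_trans _ mjN); last first.
  by rewrite addnS ltnS leq_addr.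
move/(_ isT).
move: (poisson_moment N m) (poisson_moment N m.+1) (poisson_moment N m.+2).
move=> a b c; lra.
Qed.

Lemma cvg_poisson_moment m : poisson_moment N m @[N --> \oo] --> s ^+ m.
Proof.
elim: m => [|m IH].
  rewrite expr0; apply: cvg_near_cst; near=> N; apply: poisson_moment0.
  by near: N; exact: nbhs_infty_gt.
pose d N := poisson_moment N m.+1 - s * poisson_moment N m.
have d0 : d N @[N --> \oo] --> 0.
  rewrite -(cvg_shiftn m.+1); apply/norm_cvg0P.
  apply: (squeeze_cvgr (f := fun=> 0) (h := fun N => 2 * s ^+ N)).
  - near=> N; rewrite normr_ge0 /=; apply: poisson_moment_step.
    by rewrite addnC addnS.
  - exact: cvg_cst.
  - rewrite -[X in _ --> X](mulr0 2); apply: cvgMl_tmp; apply: cvg_expr.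
    by rewrite ger0_norm.
have -> : s ^+ m.+1 = 0 + s * s ^+ m by rewrite add0r exprS.
have -> : (fun N => poisson_moment N m.+1) =
    (fun N => d N + s * poisson_moment N m).
  by apply/funext => N; rewrite /d subrK.
by apply: cvgD => //; exact: cvgMl_tmp.
Unshelve. all: by end_near.
Qed.

(** Since the normalized Poisson weights exceed [p], subtracting [p] from them
    leaves nonnegative weights of mass [1 - p]; without that subtraction this
    is the maximum principle. *)
Lemma poisson_bound (V : normedModType R) (x : nat -> V) M p :
    cosine_bounded x M -> 0 <= p -> p <= ((1 - s) / (1 + s)) ^+ 2 ->
  forall e, 0 < e -> \forall n \near \oo,
    `|(\sum_(m < n) s ^+ m *: x m) - p *: x 0%N| <= (1 - p) * (M + e).
Proof.
move=> xM p0 ps e e0.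
have sp : 0 < 1 + s by rewrite ltr_wpDr.
have p1 : 0 <= 1 - p.
  rewrite subr_ge0 (le_trans ps) // exprn_ile1 //.
    by rewrite divr_ge0 ?ltW // subr_gt0.
  by rewrite ler_pdivrMr // mul1r lerD2l ge0_cp.
pose w N t := (poisson_denom t)^-1 / poisson_mass N - p.
have w0 N t : (0 < N)%N -> 0 <= w N t.
  move=> N0; rewrite subr_ge0 (le_trans ps) //.
  rewrite ler_pdivlMr ?poisson_mass_gt0 //.
  apply: le_trans (ler_wpM2l _ (poisson_mass_le N0)) _.
    by rewrite exprn_ge0 // divr_ge0 ?ltW // subr_gt0.
  rewrite expr_div_n mulrAC divff ?mul1r ?gt_eqF //.
  by rewrite lef_pV2 ?poisson_denom_le // posrE ?poisson_denom_gt0 ?exprn_gt0.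
have wE N m : (0 < N)%N -> node_mean N (fun t => w N t * cos (m%:R * t)) =
    poisson_moment N m - p * node_mean N (fun t => cos (m%:R * t)).
  move=> N0; rewrite /poisson_moment [X in X - _]mulrC -node_meanZ -mulNr.
  rewrite -node_meanZ -node_meanD /node_mean; congr (_ * _).
  by apply: eq_bigr => k _; rewrite /w; ring.
have w1 : \forall N \near \oo, node_mean N (fun t => `|w N t|) <= 1 - p.
  near=> N; have N0 : (0 < N)%N by near: N; exact: nbhs_infty_gt.
  rewrite -(poisson_moment0 N0) -[X in _ - X]mulr1 -(node_mean_cos0 N0) -wE //.
  by apply: node_mean_le => t; rewrite ger0_norm ?w0 // mul0r cos0 mulr1.
pose j m := s ^+ m - p * (m == 0%N)%:R.
have wj m : node_mean N (fun t => w N t * cos (m%:R * t)) @[N --> \oo] --> j m.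
  apply: (@cvg_trans _ ((poisson_moment N m - p * (m == 0%N)%:R)
    @[N --> \oo])); last by apply: cvgB; [exact: cvg_poisson_moment|exact: cvg_cst].
  apply: near_eq_cvg; near=> N.
  have mN : (m < N)%N by near: N; exact: nbhs_infty_gt.
  rewrite wE ?(leq_ltn_trans _ mN) //; congr (_ - p * _).
  case: (posnP m) mN => [-> N0|m0 mN]; first by rewrite node_mean_cos0.
  by rewrite node_mean_cos ?m0 // gtn_eqF.
have := cosine_bounded_moments xM p1 w1 wj e0 => h; near=> n.
have n0 : (0 < n)%N by near: n; exact: nbhs_infty_gt.
have -> : \sum_(m < n) s ^+ m *: x m - p *: x 0%N = \sum_(m < n) j m *: x m.
  rewrite (bigD1 (Ordinal n0)) //= [RHS](bigD1 (Ordinal n0)) //= addrAC.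
  rewrite -scalerBl /j mulr1; congr (_ + _); apply: eq_bigr => i.
  by rewrite -val_eqE /= => /negbTE ->; rewrite mulr0 subr0.
by near: n.
Unshelve. all: by end_near.
Qed.
End PoissonNodes.

(** * Power series with quaternionic coefficients *)

Section PowerSeries.
Context {R : realType}.
Implicit Types (a c : nat -> quat R) (q u v : quat R) (r : R).

(** This is how radii are sent to 1: estimates on a circle of radius [t] come
    with powers of [t], and only their limit is sharp. *)
Lemma le_of_exp_mul r (x y : R) n : r < 1 ->
  (forall t, r < t < 1 -> t ^+ n * x <= y) -> x <= y.
Proof.
move=> r1 h; have lim1 : t ^+ n * x @[t --> 1^'-] --> x.
  rewrite -[X in _ --> X]mul1r; apply: cvgMr_tmp; rewrite -[X in _ --> X](expr1n _ n).
  by apply: cvg_at_left_filter; exact: exprn_continuous.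
apply: (cvgr_to_le lim1); near=> t; apply: h.
by apply/andP; split; near: t; [exact: nbhs_left_gt|exact: nbhs_left_lt].
Unshelve. all: by end_near.
Qed.

Definition ball_summable a :=
  forall r, 0 <= r < 1 -> cvgn (series (fun n => r ^+ n * `|a n|)).

(** The quaternions being a finite-dimensional space, summability is checked on
    the four coordinates. *)
Lemma quat_series_cvg (x : nat -> quat R) :
  cvgn (series (fun n => `|x n|)) -> cvgn (series x).
Proof.
move=> sx.
have coord (p : quat R -> R) : (forall y, p y ^+ 2 <= `|y| ^+ 2) ->
    cvgn (series (fun n => p (x n))).
  move=> py; apply: (@normed_cvg R R^o).
  apply: (series_le_cvg _ _ _ sx) => n //=.
  by rewrite -(@ler_pXn2r _ 2) ?nnegrE // real_normK ?num_real.
have l1 : cvgn (series (fun n => q_re (x n))).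
  by apply: coord => y; rewrite normq_sqr /dotq -!expr2 -!addrA lerDl !addr_ge0 ?sqr_ge0.
have l2 : cvgn (series (fun n => q_i (x n))).
  apply: coord => y; rewrite normq_sqr /dotq -!expr2 -!addrA addrCA lerDl.
  by rewrite !addr_ge0 ?sqr_ge0.
have l3 : cvgn (series (fun n => q_j (x n))).
  apply: coord => y; rewrite normq_sqr /dotq -!expr2 addrAC lerDr.
  by rewrite !addr_ge0 ?sqr_ge0.
have l4 : cvgn (series (fun n => q_k (x n))).
  by apply: coord => y; rewrite normq_sqr /dotq -!expr2 lerDr !addr_ge0 ?sqr_ge0.
have -> : series x = (fun n =>
    series (fun n => q_re (x n)) n *: Quat 1 0 0 0
    + series (fun n => q_i (x n)) n *: Quat 0 1 0 0
    + series (fun n => q_j (x n)) n *: Quat 0 0 1 0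
    + series (fun n => q_k (x n)) n *: Quat 0 0 0 1).
  apply/funext => n; rewrite /series /= !scaler_suml -!big_split /=.
  by apply: eq_bigr => i _; apply: quatP => /=; ring.
apply/cvg_ex; eexists; apply: cvgD; last by apply: cvgZr_tmp; exact: l4.
apply: cvgD; last by apply: cvgZr_tmp; exact: l3.
by apply: cvgD; apply: cvgZr_tmp; [exact: l1|exact: l2].
Qed.

(** At a real point between [r] and 1 the terms of the series tend to zero, so they
    are bounded; this gives a geometric comparison at radius [r]. *)
Lemma expansion_summable f a : is_expansion f a -> ball_summable a.
Proof.
move=> fa r /andP[r0 r1]; pose t := (r + 1) / 2.
have rt : r < t by rewrite /t; lra.
have t1 : t < 1 by rewrite /t; lra.
have t0 : 0 < t := le_lt_trans r0 rt.
have nt : `|t *: 1 : quat R| = t by rewrite normrZ normq1 mulr1 gtr0_norm.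
have /fa ct : unit_ball (t *: 1 : quat R) by rewrite /unit_ball /= nt.
have /cvg_series_cvg_0 z0 : cvgn (series (fun n => (t *: 1) ^+ n * a n)).
  by apply/cvg_ex; eexists; exact: ct.
have /cvg_seq_bounded[K [_ /(_ (K + 1))]] :
    cvgn (fun n => (t *: 1) ^+ n * a n) by apply/cvg_ex; eexists; exact: z0.
rewrite ltrDl ltr01 => /(_ isT) bK.
have K0 : 0 <= K + 1 by apply: le_trans (normr_ge0 _) (bK 0%N Logic.I).
apply: (@series_le_cvg _ _ (geometric (K + 1) (r / t))).
- by move=> n; rewrite mulr_ge0 ?exprn_ge0.
- move=> n; apply: mulr_ge0 => //; apply: exprn_ge0; apply: divr_ge0 => //.
  exact: ltW.
- move=> n; have an : `|(t *: 1) ^+ n * a n| <= K + 1 := bK n Logic.I.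
  rewrite normqM normqX nt in an.
  rewrite /geometric /= expr_div_n mulrCA ler_wpM2l ?exprn_ge0 //.
  by rewrite ler_pdivlMr ?exprn_gt0 // mulrC.
- have rt0 : 0 <= r / t by rewrite divr_ge0 // ltW.
  have rt1 : r / t < 1 by rewrite ltr_pdivrMr // mul1r.
  by apply: (@is_cvg_geometric_series R (K + 1) (r / t)); rewrite ger0_norm.
Qed.

Lemma ball_summable_scale a c (k : R) : 0 <= k ->
  (forall n, `|c n| <= k * `|a n|) -> ball_summable a -> ball_summable c.
Proof.
move=> k0 ca sa r r01; have /andP[r0 _] := r01.
apply: (@series_le_cvg _ _ (k *: (fun n => r ^+ n * `|a n|))).
- by move=> n; rewrite mulr_ge0 ?exprn_ge0.
- by move=> n; rewrite mulr_ge0 // mulr_ge0 ?exprn_ge0.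
- move=> n; have -> : (k *: (fun n => r ^+ n * `|a n|)) n = k * (r ^+ n * `|a n|) by [].
  by rewrite mulrCA ler_wpM2l ?exprn_ge0.
- by apply: is_cvg_seriesZ; exact: sa.
Qed.

Lemma power_series_cvg a q : ball_summable a -> `|q| < 1 ->
  series (fun n => q ^+ n * a n) @ \oo --> power_series a q.
Proof.
move=> sa q1; have := sa `|q|; rewrite normr_ge0 q1 => /(_ isT).
have -> : (fun n => `|q| ^+ n * `|a n|) = (fun n => `|q ^+ n * a n|).
  by apply/funext => n; rewrite normqM normqX.
exact: quat_series_cvg.
Qed.

Lemma power_series_lim a q (l : quat R) :
  series (fun n => q ^+ n * a n) @ \oo --> l -> power_series a q = l.
Proof. by apply: cvg_lim; exact: norm_hausdorff. Qed.

(** The right-hand side mentions neither [c] nor [q]: this uniformity lets a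
    single truncation serve all rotations and all angles. *)
Lemma power_series_tail a c (k : R) r q (l : quat R) n : ball_summable a ->
    (forall n, `|c n| <= k * `|a n|) -> 0 <= r < 1 -> `|q| <= r ->
    series (fun n => q ^+ n * c n) @ \oo --> l ->
  `|l - \sum_(i < n) q ^+ i * c i| <=
    k * (limn (series (fun n => r ^+ n * `|a n|))
         - series (fun n => r ^+ n * `|a n|) n).
Proof.
move=> sa ca r01 qr cl; set T := series (fun n => r ^+ n * `|a n|).
have /andP[r0 r1] := r01.
have cT : cvgn T := sa r r01.
have -> : \sum_(i < n) q ^+ i * c i = series (fun n => q ^+ n * c n) n.
  by rewrite /series /= big_mkord.
set S := series _ in cl *.
have cS : `|S m - S n| @[m --> \oo] --> `|l - S n|.
  by apply: cvg_norm; apply: cvgB => //; exact: cvg_cst.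
have cT' : k * (T m - T n) @[m --> \oo] --> k * (limn T - T n).
  by apply: cvgMl_tmp; apply: cvgB => //; exact: cvg_cst.
apply: (ler_cvg_to cS cT'); near=> m.
have nm : (n <= m)%N by near: m; exact: nbhs_infty_ge.
rewrite !sub_series_geq // mulr_sumr; apply: le_trans (ler_norm_sum _ _ _) _.
apply: ler_sum => i _; rewrite normqM normqX.
by rewrite mulrCA ler_pM ?exprn_ge0 // lerXn2r ?nnegrE.
Unshelve. all: by end_near.
Qed.
End PowerSeries.

(** * Regular diameters *)

Section RegularDiameter.
Context {R : realType}.
Implicit Types (f : quat R -> quat R) (a : nat -> quat R) (u v q : quat R).

Definition rot_coef a u v n : quat R := (u ^+ n - v ^+ n) * a n.

Lemma rot_coef_le a u v n : `|u| <= 1 -> `|v| <= 1 ->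
  `|rot_coef a u v n| <= 2 * `|a n|.
Proof.
move=> u1 v1; rewrite normqM ler_wpM2r //.
apply: le_trans (ler_normB _ _) _; rewrite mulr2n lerD // normqX exprn_ile1 //.
Qed.

Lemma rot_coef_summable a u v : `|u| <= 1 -> `|v| <= 1 ->
  ball_summable a -> ball_summable (rot_coef a u v).
Proof.
by move=> u1 v1; apply: (@ball_summable_scale _ _ _ 2) => // n; apply: rot_coef_le.
Qed.

Lemma slice_rotB f u v q : ball_summable (slice_coef f) ->
    `|u| <= 1 -> `|v| <= 1 -> `|q| < 1 ->
  slice_rot f u q - slice_rot f v q = power_series (rot_coef (slice_coef f) u v) q.
Proof.
move=> sa u1 v1 q1; have rot_cvg (z : quat R) : `|z| <= 1 ->
    series (fun n => q ^+ n * (z ^+ n * slice_coef f n)) @ \oo --> slice_rot f z q.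
  move=> z1; apply: power_series_cvg => //.
  apply: (@ball_summable_scale _ _ _ 1 ler01) sa => n.
  by rewrite mul1r normqM normqX ler_piMl // exprn_ile1.
apply/esym/power_series_lim.
have -> : series (fun n => q ^+ n * rot_coef (slice_coef f) u v n) =
    (fun n => series (fun n => q ^+ n * (u ^+ n * slice_coef f n)) n
      - series (fun n => q ^+ n * (v ^+ n * slice_coef f n)) n).
  apply/funext => n; rewrite /series /= -sumrB; apply: eq_bigr => i _.
  by rewrite /rot_coef mulrBl mulrBr.
by apply: cvgB; apply: rot_cvg.
Qed.

Lemma regular_diameter_le f r D :
    (forall u v q, `|u| <= 1 -> `|v| <= 1 -> `|q| <= r ->
      `|slice_rot f u q - slice_rot f v q| <= D) ->
  (regular_diameter f r <= D%:E)%E.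
Proof.
move=> h; apply: ge_ereal_sup => d [u [v [q [u1 v1 qr ->]]]].
by rewrite lee_fin h.
Qed.

Lemma le_regular_diameter f r u v q : `|u| <= 1 -> `|v| <= 1 -> `|q| <= r ->
  (`|slice_rot f u q - slice_rot f v q|%:E <= regular_diameter f r)%E.
Proof. by move=> u1 v1 qr; apply: ereal_sup_ubound; exists u, v, q. Qed.

Lemma regular_diameter_mono f r r' : r <= r' ->
  (regular_diameter f r <= regular_diameter f r')%E.
Proof.
move=> rr'; apply: ge_ereal_sup => d [u [v [q [u1 v1 qr ->]]]].
by apply: le_regular_diameter => //; exact: le_trans rr'.
Qed.

(** The limit defining the diameter of the ball exists by monotonicity. *)
Lemma regular_diameter_le_ball f r : r < 1 ->
  (regular_diameter f r <= regular_diameter_ball f)%E.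
Proof.
move=> r1; apply: lime_ge; last first.
  near=> t; apply: regular_diameter_mono; apply: ltW.
  by near: t; exact: nbhs_left_gt.
apply/cvg_ex; eexists; apply/cvg_at_leftNP.
apply: (nonincreasing_at_right_cvge (BInfty R false)) => // x y _ _ xy.
by apply: regular_diameter_mono; rewrite lerN2.
Unshelve. all: by end_near.
Qed.

(** Without an expansion the coefficients default to zero, and so does the
    diameter. *)
Lemma slice_coef_expansion f : regular_diameter_ball f <> 0%E ->
  is_expansion f (slice_coef f).
Proof.
move=> D0; apply: xgetPex; apply: contrapT => noexp; apply: D0.
have coef0 : slice_coef f = fun=> 0.
  by apply: xgetPN => a fa; apply: noexp; exists a.
have rot0 u q : slice_rot f u q = 0.
  apply: power_series_lim; rewrite coef0.
  have -> : series (fun n => q ^+ n * (u ^+ n * 0)) = fun=> 0.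
    apply/funext => n; rewrite /series /= big1 // => i _.
    by rewrite !mulr0.
  exact: cvg_cst.
apply: lim_near_cst => //; near=> r; apply/eqP; rewrite eq_le; apply/andP; split.
  by apply: regular_diameter_le => u v q _ _ _; rewrite !rot0 subrr normr0.
have -> : 0%E = `|slice_rot f 0 0 - slice_rot f 0 0|%:E by rewrite subrr normr0.
apply: le_regular_diameter; rewrite normr0 ?ler01 //.
by near: r; exact: nbhs_left_ge.
Unshelve. all: by end_near.
Qed.
End RegularDiameter.

(** * A Schwarz lemma for differences of rotations *)

Section Schwarz.
Context {R : realType}.
Variable a : nat -> quat R.
Hypothesis sa : ball_summable a.
Hypothesis spread : forall u v q : quat R, `|u| <= 1 -> `|v| <= 1 -> `|q| < 1 ->
  `|power_series (rot_coef a u v) q| <= 2.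
Implicit Types (u v w q : quat R) (r e : R).

Lemma rot_partial_bound r e : 0 <= r < 1 -> 0 < e -> \forall n \near \oo,
  forall u v q, `|u| <= 1 -> `|v| <= 1 -> `|q| <= r ->
    `|\sum_(i < n) q ^+ i * rot_coef a u v i| <= 2 + e.
Proof.
move=> r01 e0; set T := series (fun n => r ^+ n * `|a n|).
have cT : 2 * (limn T - T n) @[n --> \oo] --> 2 * (limn T - limn T).
  apply: cvgMl_tmp; apply: cvgB; first exact: cvg_cst.
  exact: sa.
rewrite subrr mulr0 in cT.
move/cvgr_le: cT => /(_ e e0); apply: filterS => n Tn u v q u1 v1 qr.
have /andP[r0 r1] := r01.
have q1 := le_lt_trans qr r1.
have tail := power_series_tail n sa (fun m => rot_coef_le a m u1 v1) r01 qr
  (power_series_cvg (rot_coef_summable u1 v1 sa) q1).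
set g := power_series _ _ in tail; set S := \sum_(i < n) _ in tail *.
rewrite -[S](subKr g); apply: le_trans (ler_normB _ _) _.
by rewrite lerD ?spread // (le_trans tail).
Qed.

Lemma rot_coef0 u v : rot_coef a u v 0 = 0.
Proof. by rewrite /rot_coef !expr0 subrr mul0r. Qed.

Lemma rot_sum_shift u v q n :
  \sum_(i < n.+1) q ^+ i * rot_coef a u v i =
  q * \sum_(i < n) q ^+ i * rot_coef a u v i.+1.
Proof.
rewrite big_ord_recl rot_coef0 mulr0 add0r mulr_sumr.
by apply: eq_bigr => i _; rewrite exprS mulrA.
Qed.

(** On the circle of radius [|w|], division by the variable costs exactly
    [1 / |w|]; turning [w] by [expi I t] and [expi I (- t)] and taking the mean
    leaves cosines only. *)
Lemma rot_cosine_bounded u v w : `|u| <= 1 -> `|v| <= 1 -> 0 < `|w| < 1 ->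
  cosine_bounded (fun m => w ^+ m * rot_coef a u v m.+1) (2 / `|w|).
Proof.
move=> u1 v1 /andP[w0 w1] e e0; have [I II Iw] := exists_imag_unit_comm w.
have ew0 : 0 < e * `|w| by rewrite mulr_gt0.
have := @rot_partial_bound `|w| (e * `|w|); rewrite normr_ge0 w1.
move=> /(_ isT ew0)[n0 _ Hn]; exists n0 => // n /= n0n t.
pose A x := \sum_(i < n) (expi I x * w) ^+ i * rot_coef a u v i.+1.
have A_le x : `|A x| <= 2 / `|w| + e.
  rewrite -(ler_pM2l w0) mulrDr mulrCA divff ?gt_eqF // mulr1 [_ * e]mulrC.
  have nx : `|expi I x * w| = `|w| by rewrite normqM normq_expi ?mul1r.
  rewrite -[X in X * `|A _|]nx -normqM -rot_sum_shift.
  by apply: Hn => //=; rewrite ?nx // (leq_trans n0n).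
have -> : cosine_sum (fun m => w ^+ m * rot_coef a u v m.+1) n t =
    2^-1 *: (A t + A (- t)).
  rewrite /A -big_split /= scaler_sumr; apply: eq_bigr => i _.
  rewrite !exprMn_comm; try exact: expi_comm.
  rewrite !expiX // -!mulrA -mulrDl mulrN.
  have := expi_addN 0 (i%:R * t) II; rewrite add0r sub0r => ->.
  by rewrite expi0 -scalerAl mul1r scalerA mulKf.
rewrite normrZ ger0_norm ?invr_ge0 // ler_pdivrMl // [leRHS]mulr_natl [leRHS]mulr2n.
by apply: le_trans (ler_normD _ _) _; rewrite lerD.
Qed.

(** For [u = 1] and [v = -1] the constant coefficient after division by the
    variable is [2 a 1]. *)
Lemma coef1_le1 : `|a 1%N| <= 1.
Proof.
apply: (@le_of_exp_mul _ 0 _ _ 1) => // r /andP[r0 r1].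
have nr : `|r *: 1 : quat R| = r by rewrite normrZ normq1 mulr1 gtr0_norm.
have := @rot_cosine_bounded 1 (-1) (r *: 1); rewrite normrN normq1 nr r0 r1.
move=> /(_ (lexx _) (lexx _) isT) /cosine_coef0_bound.
rewrite expr0 mul1r /rot_coef !expr1 opprK mulrDl mul1r -mulr2n normrMn.
by rewrite -[leLHS]mulr_natl ler_pM2l // -div1r ler_pdivlMr // mulrC.
Qed.

(** The constant [p] bounds from below the Poisson kernels that recover the
    values on the ball of radius [r] from circles of radius close to 1; it gives
    the constant coefficient [(u - v) a 1] a definite share in every value. *)
Lemma rot_schwarz r : 0 < r < 1 -> exists2 p : R, 0 < p <= 1 &
  forall u v q, `|u| <= 1 -> `|v| <= 1 -> `|q| <= r ->
    `|power_series (rot_coef a u v) q| <= `|q| * (2 - 2 * p * (1 - `|a 1%N|)).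
Proof.
move=> /andP[r0 r1].
(* Circles of radius at least r / t only involve Poisson parameters below t. *)
pose t := (1 + r) / 2.
have rt : r < t by rewrite /t; lra.
have t1 : t < 1 by rewrite /t; lra.
have t0 : 0 < t by exact: lt_trans rt.
pose p := ((1 - t) / 2) ^+ 2.
have p0 : 0 < p by rewrite exprn_gt0 // divr_gt0 // subr_gt0.
have p1 : p <= 1 by rewrite exprn_ile1 //; lra.
exists p; first by rewrite p0.
move=> u v q u1 v1 qr.
have rt1 : r / t < 1 by rewrite ltr_pdivrMr // mul1r.
apply: (@le_of_exp_mul _ (r / t) _ _ 1) => // rho /andP[rtrho rho1].
have rho0 : 0 < rho by apply: lt_trans rtrho; rewrite divr_gt0.
pose s := `|q| / rho.
have s0 : 0 <= s by rewrite divr_ge0 // ltW.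
have st : s <= t.
  rewrite ler_pdivrMr // (le_trans qr) //.
  by move: rtrho; rewrite ltr_pdivrMr // mulrC => /ltW.
have s1 : s < 1 := le_lt_trans st t1.
have [w nw qw] : exists2 w, `|w| = rho & q = s *: w.
  have [q0|q0] := eqVneq q 0.
    exists (rho *: 1); first by rewrite normrZ normq1 mulr1 gtr0_norm.
    by rewrite /s q0 normr0 mul0r scale0r.
  exists ((rho / `|q|) *: q).
    rewrite normrZ normrM normfV normr_id divfK ?normr_eq0 //.
    by rewrite gtr0_norm.
  rewrite scalerA /s mulrA divfK ?gt_eqF // divff ?normr_eq0 //.
  by rewrite scale1r.
have ps : p <= ((1 - s) / (1 + s)) ^+ 2.
  rewrite lerXn2r ?nnegrE ?divr_ge0 //; try lra.
  by rewrite ler_pM ?invr_ge0 ?lef_pV2 ?posrE //; lra.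
have w01 : 0 < `|w| < 1 by rewrite nw rho0 rho1.
have q1 : `|q| < 1 := le_lt_trans qr r1.
have s01 : 0 <= s < 1 by rewrite s0 s1.
set g := power_series _ q.
have g_le e : 0 < e -> `|g| <= `|q| * ((1 - p) * (2 / rho + e) + p * (2 * `|a 1%N|)).
  move=> e0; have := poisson_bound s01 (rot_cosine_bounded u1 v1 w01) (ltW p0) ps e0.
  rewrite nw expr0 mul1r => bound.
  have cg : `|\sum_(i < n.+1) q ^+ i * rot_coef a u v i| @[n --> \oo] --> `|g|.
    pose S := series (fun n => q ^+ n * rot_coef a u v n).
    have SE n : \sum_(i < n.+1) q ^+ i * rot_coef a u v i = S n.+1.
      by rewrite /S /series /= big_mkord.
    under eq_cvg => n do rewrite SE.
    have : `|S n| @[n --> \oo] --> `|g|.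
      apply: cvg_norm.
      exact: (power_series_cvg (rot_coef_summable u1 v1 sa) q1).
    by rewrite -(cvg_shiftS (fun n => `|S n|)).
  apply: (cvgr_to_le cg); apply: filterS bound => n bound.
  rewrite rot_sum_shift normqM ler_wpM2l //.
  have -> : \sum_(i < n) q ^+ i * rot_coef a u v i.+1 =
      \sum_(i < n) s ^+ i *: (w ^+ i * rot_coef a u v i.+1).
    by apply: eq_bigr => i _; rewrite {1}qw exprZn scalerAl.
  set S := \sum_(i < n) _ in bound *; rewrite -[S](subrK (p *: rot_coef a u v 1)).
  apply: le_trans (ler_normD _ _) _; rewrite lerD // normrZ gtr0_norm //.
  by rewrite ler_pM2l //; exact: rot_coef_le.
have {}g_le : `|g| <= `|q| * ((1 - p) * (2 / rho) + p * (2 * `|a 1%N|)).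
  apply/ler_addgt0Pr => e e0; apply: le_trans (g_le e e0) _.
  have -> : `|q| * ((1 - p) * (2 / rho + e) + p * (2 * `|a 1%N|)) =
      `|q| * ((1 - p) * (2 / rho) + p * (2 * `|a 1%N|)) + `|q| * ((1 - p) * e).
    by ring.
  rewrite lerD2l mulrA ler_piMl ?(ltW e0) // mulr_ile1 ?subr_ge0 //.
    exact: ltW.
  by rewrite gerBl (ltW p0).
apply: le_trans (ler_wpM2l (ltW rho0) g_le) _.
rewrite mulrCA ler_wpM2l //.
have -> : rho * ((1 - p) * (2 / rho) + p * (2 * `|a 1%N|)) =
    (1 - p) * 2 + rho * (p * (2 * `|a 1%N|)) by field; rewrite gt_eqF.
have : rho * (p * (2 * `|a 1%N|)) <= p * (2 * `|a 1%N|).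
  apply: ler_piMl; last exact: ltW.
  by apply: mulr_ge0; [exact: ltW|apply: mulr_ge0].
lra.
Qed.
End Schwarz.

(** * The extremal coefficients *)

Section Extremal.
Context {R : realType}.
Variable a : nat -> quat R.
Hypothesis sa : ball_summable a.
Hypothesis spread : forall u v q : quat R, `|u| <= 1 -> `|v| <= 1 -> `|q| < 1 ->
  `|power_series (rot_coef a u v) q| <= 2.
Hypothesis a1 : `|a 1%N| = 1.
Implicit Types (I q : quat R) (r d x : R).

(** For [u = 1] and [v = -1] the constant coefficient [2 a 1] already has norm 2.
    The bound on its sum and its difference with half of another coefficient then
    leaves, by the parallelogram law, no room for the latter. *)
Lemma odd_coef_eq0 n : odd n -> (1 < n)%N -> a n = 0.
Proof.
case: n => [//|m] om m0; have {}m0 : (0 < m)%N := m0.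
suff : 4 + `|a m.+1| ^+ 2 <= 4.
  rewrite gerDl => h; apply/eqP; rewrite -normr_eq0 -sqrf_eq0.
  by rewrite eq_le h sqr_ge0.
apply: (@le_of_exp_mul _ 0 _ _ (2 * m + 2)) => // r /andP[r0 r1].
have nr : `|r *: 1 : quat R| = r by rewrite normrZ normq1 mulr1 gtr0_norm.
have := @rot_cosine_bounded _ _ sa spread 1 (-1) (r *: 1).
rewrite normrN normq1 nr r0 r1 => /(_ (lexx _) (lexx _) isT) xM.
set X := (fun m => _) in xM.
have Xp := @cosine_coef_bound _ _ _ _ _ 1 xM m0; rewrite normr1 in Xp.
have Xm := @cosine_coef_bound _ _ _ _ _ (-1) xM m0; rewrite normrN normr1 in Xm.
have X0 : X 0%N = 2 *: a 1%N.
  by rewrite /X expr0 mul1r /rot_coef !expr1 opprK scaler_nat mulrDl mul1r mulr2n.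
have Xn : (1 / 2) *: X m = r ^+ m *: a m.+1.
  rewrite /X /rot_coef expr1n -signr_odd om expr1 opprK exprZn expr1n.
  rewrite -scalerAl !mul1r mulrDl !mul1r -mulr2n.
  rewrite -[a m.+1 *+ 2]scaler_nat !scalerA.
  by congr (_ *: _); field.
have {}Xp := Xp (lexx _); have {}Xm := Xm (lexx _).
rewrite mulNr scaleNr Xn X0 in Xm; rewrite Xn X0 in Xp.
have sq (y : quat R) : `|y| <= 2 / r -> `|y| ^+ 2 <= 4 / r ^+ 2.
  move=> yr; have r2 : 0 <= 2 / r := le_trans (normr_ge0 _) yr.
  by rewrite (natrX R 2 2) -expr_div_n lerXn2r ?nnegrE.
have := sq _ Xp; have := sq _ Xm; rewrite normqB_sqr normqD_sqr.
rewrite !normrZ a1 mulr1 !gtr0_norm ?exprn_gt0 //.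
move: (dotq _ _ *+ 2) => D h1 h2.
have h : 4 + r ^+ (2 * m) * `|a m.+1| ^+ 2 <= 4 / r ^+ 2.
  rewrite mulnC exprM -exprMn; lra.
rewrite ler_pdivlMr ?exprn_gt0 // in h.
apply: le_trans h; rewrite exprD mulrAC mulrDr [in leRHS]mulrDl mulrDl.
rewrite lerD // ler_wpM2r ?exprn_ge0 ?(ltW r0) // ler_piMl //.
by rewrite exprn_ile1 ?(ltW r0) ?(ltW r1).
Qed.

(** On a circle [z = r expi I x], the tangential derivative of [z^n a n] is
    [n r^n I expi I (n x) a n], while the chord between opposite points points in the
    direction [expi I x * a 1]. Up to the factor [n r^n], [twist] is the inner
    product of the two for [n = m + 1], after cancelling [expi I x]. *)
Definition twist I m x : R := dotq (a 1%N) (I * (expi I (m%:R * x) * a m.+1)).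

Lemma twist0 I x : I ^+ 2 = -1 -> twist I 0 x = 0.
Proof.
move=> II; rewrite /twist mul0r expi0 mul1r /dotq /= (imag_unit_re0 II).
by ring.
Qed.

Lemma twist_addN I m x t : I ^+ 2 = -1 ->
  twist I m (x + t) + twist I m (x - t) = 2 * cos (m%:R * t) * twist I m x.
Proof.
move=> II; rewrite /twist -dotqDr -mulrDr -mulrDl mulrDr mulrBr expi_addN //.
by rewrite -scalerAl -scalerAr dotqZr.
Qed.

Section Chords.
Variables (I : quat R) (r d : R).
Hypothesis II : I ^+ 2 = -1.
Hypothesis r01 : 0 < r < 1.

Let r0 : 0 < r. Proof. by case/andP: r01. Qed.
Let r1 : r < 1. Proof. by case/andP: r01. Qed.

Definition chord_coef m : R := 8 * r ^+ m.+2 * (cos d * sin (m.+1%:R * d)).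

(** With odd coefficients gone, the difference of the values at [r expi (x + d)]
    and [- r expi (x - d)] splits into a linear part [A] and a part [B] that is odd
    in [d]. Both [A + B] and [A - B] are thus bounded by the diameter, which by
    the parallelogram law leaves for [2 <A, B>] only the defect [4 - |A|^2]. *)
Lemma chord_bound e : 0 < e -> \forall n \near \oo, forall x,
  `|\sum_(m < n) chord_coef m.+1 * twist I m.+1 x| <=
    (2 + e) ^+ 2 - 4 * r ^+ 2 * cos d ^+ 2.
Proof.
move=> e0; have r01' : 0 <= r < 1 by rewrite ltW.
have [n0 _ Hn] := rot_partial_bound sa spread r01' e0; exists n0 => // n /= n0n x.
pose A : quat R := (2 * r * cos d) *: (expi I x * a 1%N).
pose B t : quat R := \sum_(m < n)
  (2 * r ^+ m.+2 * sin (m.+2%:R * t)) *: (I * (expi I (m.+2%:R * x) * a m.+2)).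
have AB t : cos t = cos d -> `|A + B t| <= 2 + e.
  move=> td; have := Hn n.+2 (leqW (leqW n0n)) (expi I (x + t)) (- expi I (x - t))
    (r *: 1).
  rewrite normrN !normq_expi // normrZ normq1 mulr1 gtr0_norm //.
  move=> /(_ (lexx _) (lexx _) (lexx _)); rewrite rot_sum_shift -normrN.
  congr (_ <= _); rewrite normrN; congr `|_|.
  rewrite big_ord_recl expr0 mul1r mulrDr; congr (_ + _).
    rewrite /rot_coef !expr1 opprK expi_addN // /A -td.
    by apply: quatP => /=; ring.
  rewrite mulr_sumr; apply: eq_bigr => i _; rewrite /=.
  rewrite mulrA -exprS exprZn expr1n -scalerAl mul1r.
  have [oi|oi] := boolP (odd i.+2).
    by rewrite /rot_coef (odd_coef_eq0 oi) // !mulr0 !scaler0.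
  rewrite /rot_coef exprNn -signr_odd (negbTE oi) expr0 mul1r !expiX //.
  rewrite mulrDr mulrBr expi_subN // -scalerAl scalerA mulrA.
  by congr (_ *: _); ring.
have ABd := AB d erefl; have ABN := AB (- d) (cosN d).
have BN : B (- d) = - B d.
  rewrite /B -sumrN; apply: eq_bigr => i _.
  by rewrite mulrN sinN mulrN scaleNr.
rewrite {}BN in ABN.
have AA : `|A| ^+ 2 = 4 * r ^+ 2 * cos d ^+ 2.
  rewrite /A normrZ exprMn normqM normq_expi // a1 real_normK ?num_real //.
  by ring.
have dotAB : dotq A (B d) *+ 2 = \sum_(m < n) chord_coef m.+1 * twist I m.+1 x.
  rewrite /B dotq_sumr -sumrMnl; apply: eq_bigr => i _.
  rewrite /A dotqZl dotqZr.
  have -> : I * (expi I (i.+2%:R * x) * a i.+2) =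
      expi I x * (I * (expi I (i.+1%:R * x) * a i.+2)).
    have -> : i.+2%:R * x = x + i.+1%:R * x by rewrite [i.+2%:R]mulrSr; ring.
    rewrite expiD // !mulrA.
    by have -> : expi I x * I = I * expi I x by exact: expi_comm.
  rewrite dotq_mull normq_expi // /chord_coef /twist [r ^+ i.+3]exprS.
  by move: (dotq _ _) (sin _) (r ^+ i.+2) => D S P; ring.
have sq (y : quat R) : `|y| <= 2 + e -> `|y| ^+ 2 <= (2 + e) ^+ 2.
  move=> ye; rewrite lerXn2r ?nnegrE //; exact: le_trans (normr_ge0 y) ye.
have := sq _ ABd; have := sq _ ABN; rewrite normqB_sqr normqD_sqr dotAB AA.
have := sqr_ge0 `|B d|; move: (\sum_(m < n) _) => D *.
by rewrite ler_norml; apply/andP; split; lra.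
Qed.

(** The bound of [chord_bound] holds at every angle, so at the mean of two angles
    symmetric about [x], where the twists become cosine terms. *)
Lemma twist_cosine_bounded x : cosine_bounded
  (fun m => chord_coef m * twist I m x : R^o) (4 - 4 * r ^+ 2 * cos d ^+ 2).
Proof.
move=> e e0.
(* With this choice (2 + e')^2 <= 4 + 5 e' <= 4 + e. *)
pose e' := Num.min 1 (e / 5).
have e'0 : 0 < e' by rewrite lt_min ltr01 divr_gt0.
have e'1 : e' <= 1 by rewrite ge_min lexx.
have e'e : e' <= e / 5 by rewrite ge_min lexx orbT.
have [n0 _ Hn] := chord_bound e'0; exists n0.+1 => // -[//|n] /= n0n t.
have -> : cosine_sum (fun m => chord_coef m * twist I m x : R^o) n.+1 t =
    ((\sum_(m < n) chord_coef m.+1 * twist I m.+1 (x + t)) +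
     (\sum_(m < n) chord_coef m.+1 * twist I m.+1 (x - t))) / 2.
  rewrite /cosine_sum big_ord_recl twist0 // mulr0 scaler0 add0r.
  rewrite -big_split mulr_suml; apply: eq_bigr => i _.
  rewrite /= -mulrDr twist_addN // /=.
  have -> (y z : R) : y *: (z : R^o) = y * z by [].
  by field.
rewrite normrM [`|2^-1|]ger0_norm // ler_pdivrMr //.
apply: le_trans (ler_normD _ _) _.
have h y := Hn n n0n y.
have : e' ^+ 2 <= e' by rewrite expr2 ler_piMl // ltW.
by have := h (x + t); have := h (x - t); lra.
Qed.
End Chords.

(** As the radius tends to 1, the coefficient bound for the cosine series of
    twists becomes [sin d ^+ 2], of second order in [d], whereas the coefficient
    itself is [sin ((m + 1) d)] times the twist, up to a factor tending to 1. *)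
Lemma twist_eq0 I m x : I ^+ 2 = -1 -> (0 < m)%N -> twist I m x = 0.
Proof.
move=> II m0; set k := twist I m x.
have bound d : `|cos d * sin (m.+1%:R * d) * k| <= sin d ^+ 2.
  suff : `|cos d * sin (m.+1%:R * d) * k| + cos d ^+ 2 <= 1.
    by have := cos2Dsin2 d; lra.
  apply: (@le_of_exp_mul _ 0 _ _ m.+2) => // r r01; have /andP[r0 r1] := r01.
  have := cosine_coefn_bound (twist_cosine_bounded d II r01 x) m0.
  rewrite -/k /chord_coef.
  rewrite (_ : _ * k = 8 * (r ^+ m.+2 * (cos d * sin (m.+1%:R * d) * k))); last by ring.
  rewrite normrM [`|8|]ger0_norm // normrM gtr0_norm ?exprn_gt0 // => h.
  have h2 : r ^+ m.+2 * cos d ^+ 2 <= r ^+ 2 * cos d ^+ 2.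
    rewrite ler_wpM2r ?sqr_ge0 // -addn2 exprD ler_piMl ?sqr_ge0 //.
    by rewrite exprn_ile1 // ltW.
  by rewrite mulrDr; lra.
apply/eqP; apply: contraT => k0.
have kpos : 0 < `|k| by rewrite normr_gt0.
have lim0 : cos d * `|k| - sin d @[d --> 0^'+] --> cos 0 * `|k| - sin 0.
  apply: (@cvg_at_right_filter _ _ (fun d => cos d * `|k| - sin d)).
  by apply: cvgB; [apply: cvgMr_tmp; exact: continuous_cos|exact: continuous_sin].
rewrite cos0 sin0 mul1r subr0 in lim0.
near (0 : R)^'+ => d.
have d0 : 0 < d by near: d; exact: nbhs_right_gt.
have dpi : d < pi / 2 / m.+1%:R.
  by near: d; apply: nbhs_right_lt; rewrite !divr_gt0 ?pi_gt0.
have dk : 0 < cos d * `|k| - sin d by near: d; apply: (cvgr_gt _ lim0).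
have m1d : m.+1%:R * d < pi / 2 by rewrite mulrC -ltr_pdivlMr.
have dm1 : d <= m.+1%:R * d by rewrite ler_peMl ?(ltW d0) // ler1n.
have dpi2 : d < pi / 2 := le_lt_trans dm1 m1d.
have sd : 0 < sin d by rewrite sin_gt0_pihalf // d0.
have cd : 0 < cos d by rewrite cos_gt0_pihalf // dpi2 andbT; lra.
have ss : sin d <= sin (m.+1%:R * d).
  by rewrite leNgt ltr_sin -?leNgt // in_itv /=; apply/andP; split; lra.
have := bound d; rewrite !normrM gtr0_norm // gtr0_norm ?(lt_le_trans sd) //.
rewrite leNgt => /negP[]; rewrite expr2.
apply: (@lt_le_trans _ _ (sin d * (cos d * `|k|))).
  by rewrite ltr_pM2l // -subr_gt0.
by rewrite mulrCA mulrA ler_wpM2r // ler_wpM2l // ltW.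
Unshelve. all: by end_near.
Qed.

(** At [x = 0] the twists give the inner products with all [I * a n]; a quarter
    turn of the angle [m x] replaces [I * a n] by a real multiple of [a n]. *)
Lemma coef_eq0 n : (1 < n)%N -> a n = 0.
Proof.
case: n => [//|m] m0; have {}m0 : (0 < m)%N := m0.
apply: (@dotq_units_eq0 _ (a 1%N)).
- by rewrite -normr_eq0 a1 oner_eq0.
- pose I : quat R := Quat 0 1 0 0.
  have II : I ^+ 2 = -1 by rewrite expr2; apply: quatP => /=; ring.
  have := twist_eq0 (- (pi / 2) / m%:R) II m0; rewrite /twist.
  rewrite mulrC divfK ?pnatr_eq0 -?lt0n // /expi cosN sinN cos_pihalf sin_pihalf.
  by rewrite scale0r add0r scaleN1r mulNr mulrN mulrA -expr2 II mulN1r opprK.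
- move=> I II; have := twist_eq0 0 II m0.
  by rewrite /twist mulr0 expi0 mul1r.
Qed.
End Extremal.

(** * The slice derivative at the origin *)

Section SliceDerivative.
Context {R : realType}.
Implicit Types (f : quat R -> quat R) (a : nat -> quat R) (q b : quat R).

Lemma expansion0 f a : is_expansion f a -> f 0 = a 0%N.
Proof.
move=> fa; have /power_series_lim <- : series (fun n => 0 ^+ n * a n) @ \oo --> f 0.
  by apply: fa; rewrite /unit_ball /= normr0.
apply: power_series_lim; apply: cvg_near_cst; near=> n.
have n0 : (0 < n)%N by near: n; exact: nbhs_infty_gt.
rewrite /series /= big_mkord (bigD1 (Ordinal n0)) //= expr0 mul1r big1 ?addr0 //.
by move=> i; rewrite -val_eqE /= => /negbTE i0; rewrite expr0n i0 mul0r.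
Unshelve. all: by end_near.
Qed.

Lemma affine_series_cvg a q : (forall n, (1 < n)%N -> a n = 0) ->
  series (fun n => q ^+ n * a n) @ \oo --> a 0%N + q * a 1%N.
Proof.
move=> a0; apply: cvg_near_cst; exists 2%N => // -[//|[//|n]] _.
rewrite /series /= big_mkord !big_ord_recl expr0 mul1r expr1 big1 ?addr0 //.
by move=> i _; rewrite a0 // mulr0.
Qed.

Lemma expansion_affine f a q : is_expansion f a ->
  (forall n, (1 < n)%N -> a n = 0) -> unit_ball q -> f q = a 0%N + q * a 1%N.
Proof.
move=> fa a0 q1; rewrite -(power_series_lim (fa q q1)).
exact/power_series_lim/affine_series_cvg.
Qed.

Lemma slice_derivative0 f a : is_expansion f a -> slice_derivative f 0 = a 1%N.
Proof.
move=> fa; have sa := expansion_summable fa.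
pose T := series (fun n => (2^-1 : R) ^+ n * `|a n|).
have cT : cvgn T by apply: sa; lra.
have T0 n : 0 <= 2^-1 ^+ n * `|a n| by rewrite mulr_ge0 ?exprn_ge0.
have T_le n : T n <= limn T.
  apply: nondecreasing_cvgn_le => //; apply/nondecreasing_seqP => m.
  by rewrite /T /series /= big_nat_recr //= lerDl.
have L0 : 0 <= limn T by apply: le_trans (T_le 0%N); rewrite /T /series /= big_geq.
have taylor (h : R) : `|h| <= 2^-1 ->
    `|f (h *: 1) - (a 0%N + h *: a 1%N)| <= 4 * `|h| ^+ 2 * limn T.
  move=> h2; have nh : `|h *: 1 : quat R| = `|h| by rewrite normrZ normq1 mulr1.
  have ch : unit_ball (h *: 1 : quat R).
    by rewrite /unit_ball /= nh (le_lt_trans h2) //; lra.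
  have cf : `|series (fun n => (h *: 1) ^+ n * a n) n - (a 0%N + h *: a 1%N)|
      @[n --> \oo] --> `|f (h *: 1) - (a 0%N + h *: a 1%N)|.
    by apply: cvg_norm; apply: cvgB; [exact: fa|exact: cvg_cst].
  apply: (cvgr_to_le cf); exists 2%N => // -[//|[//|n]] _ /=.
  apply: le_trans (_ : 4 * `|h| ^+ 2 * T n.+2 <= _); last first.
    by rewrite ler_wpM2l // mulr_ge0 ?sqr_ge0.
  rewrite /T /series /= !big_mkord !big_ord_recl expr0 mul1r expr1.
  rewrite -scalerAl mul1r addrA [X in `|X|]addrAC subrr add0r.
  apply: le_trans (ler_norm_sum _ _ _) _.
  rewrite !mulrDr addrA -[leLHS]add0r lerD ?addr_ge0 ?mulr_ge0 ?sqr_ge0 //.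
  rewrite mulr_sumr; apply: ler_sum => i _; rewrite normqM normqX nh /=.
  rewrite mulrA ler_wpM2r // !exprS.
  have := @lerXn2r R i `|h| 2^-1; rewrite !nnegrE normr_ge0 invr_ge0 ler0n h2.
  move=> /(_ isT isT isT) hi; move: hi (sqr_ge0 `|h|).
  move: (`|h| ^+ i) (2^-1 ^+ i) => x y xy h0.
  rewrite [leRHS](_ : _ = `|h| ^+ 2 * y); last by field.
  by rewrite mulrA -expr2 ler_wpM2l.
apply: cvg_lim; first exact: norm_hausdorff.
apply/cvgrPdist_le => e e0; near=> h.
have h0 : h != 0 by near: h; exact: nbhs_dnbhs_neq.
have h2 : `|h| <= 2^-1 by near: h; apply: dnbhs0_le; rewrite invr_gt0.
have he : `|h| <= e / (4 * (limn T + 1)).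
  by near: h; apply: dnbhs0_le; rewrite divr_gt0 // mulr_gt0 // ltr_wpDl.
have nh : 0 < `|h| by rewrite normr_gt0.
rewrite /= addr0 (expansion0 fa) -(ler_pM2l nh) -normrZ scalerBr scalerA divff //.
rewrite scale1r.
have -> : h *: a 1%N - (f (h *: 1) - a 0%N) = - (f (h *: 1) - (a 0%N + h *: a 1%N)).
  by rewrite !opprB addrA [a 0%N + _]addrC.
rewrite normrN; apply: le_trans (taylor h h2) _.
have L1 : 0 < 4 * (limn T + 1) by rewrite mulr_gt0 // ltr_wpDl.
rewrite ler_pdivlMr // in he; apply: le_trans (ler_wpM2l (ltW nh) he).
by have := sqr_ge0 `|h|; have := L0; move: (limn T) => L L0' hh; lra.
Unshelve. all: by end_near.
Qed.
End SliceDerivative.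

(** * The diameter version of the Landau-Toeplitz theorem *)

Theorem theorem1p4 (R : realType) (f : quat R -> quat R)
    (f_regular : slice_regular f)
    (f_diameter : regular_diameter_ball f = 2%:E) :
  [/\ forall r : R, 0 < r < 1 -> (regular_diameter f r <= (2 * r)%:E)%E,
      `|slice_derivative f 0| <= 1 &
      ((exists2 r : R, 0 < r < 1 & regular_diameter f r = (2 * r)%:E) \/
         `|slice_derivative f 0| = 1) <->
      (exists a b : quat R,
         `|b| = 1 /\ forall q, unit_ball q -> f q = a + q * b)].
Proof.
have fa : is_expansion f (slice_coef f).
  apply: slice_coef_expansion; rewrite f_diameter => -[/eqP].
  by rewrite pnatr_eq0.
have sa := expansion_summable fa.
have spread (u v q : quat R) : `|u| <= 1 -> `|v| <= 1 -> `|q| < 1 ->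
    `|power_series (rot_coef (slice_coef f) u v) q| <= 2.
  move=> u1 v1 q1; rewrite -slice_rotB // -lee_fin -f_diameter.
  apply: le_trans (regular_diameter_le_ball f q1).
  exact: le_regular_diameter.
have a1 := coef1_le1 sa spread.
(* The factor 2 of (A) drops strictly unless the first coefficient has norm 1. *)
have improved r : 0 < r < 1 -> exists2 p : R, 0 < p &
    (regular_diameter f r <= (r * (2 - 2 * p * (1 - `|slice_coef f 1%N|)))%:E)%E.
  move=> r01; have /andP[r0 r1] := r01.
  have [p /andP[p0 p1] schwarz] := rot_schwarz sa spread r01.
  exists p => //; apply: regular_diameter_le => u v q u1 v1 qr.
  rewrite slice_rotB ?(le_lt_trans qr) //; apply: le_trans (schwarz u v q u1 v1 qr) _.
  rewrite ler_wpM2r //.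
  have : p * (1 - `|slice_coef f 1%N|) <= 1 * 1.
    by rewrite ler_pM ?subr_ge0 // ?(ltW p0) // gerBl.
  lra.
split.
- move=> r r01; have /andP[r0 r1] := r01.
  have [p p0 /le_trans] := improved r r01; apply; rewrite lee_fin mulrC.
  rewrite ler_wpM2r ?(ltW r0) // gerBl mulr_ge0 ?subr_ge0 //.
  by rewrite mulr_ge0 // ltW.
- by rewrite (slice_derivative0 fa).
split; rewrite ?(slice_derivative0 fa).
- move=> eqs; have a1E : `|slice_coef f 1%N| = 1.
    case: eqs => // -[r r01 dr]; have /andP[r0 r1] := r01.
    apply/eqP; rewrite eq_le a1 /= leNgt; apply/negP => a1lt.
    have [p p0] := improved r r01; rewrite dr lee_fin mulrC ler_pM2l //.
    have : 0 < p * (1 - `|slice_coef f 1%N|) by rewrite mulr_gt0 // subr_gt0.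
    lra.
  exists (slice_coef f 0%N), (slice_coef f 1%N); split=> // q q1.
  by apply: expansion_affine => // n; apply: coef_eq0.
- move=> [a [b [b1 fab]]]; right.
  pose c n : quat R := if n is n'.+1 then (if n' is 0 then b else 0) else a.
  have fc : is_expansion f c.
    move=> q q1; rewrite fab //; apply: (@affine_series_cvg _ c).
    by case=> [//|[//|n]].
  by rewrite -(slice_derivative0 fa) (slice_derivative0 fc).
Qed.
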